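(* The proof rule US, which infers $\sigma(\phi)$ from $\phi$, is sound, where $\sigma(\phi)$ denotes $\sigma^{\emptyset}(\phi)$ and the rule applies only when this is defined. That is: for every uniform substitution $\sigma$ and every dGL formula $\phi$ such that $\sigma^{\emptyset}(\phi)$ is defined, if $\phi$ is valid then $\sigma^{\emptyset}(\phi)$ is valid.
   Context: Differential game logic (dGL). Fix a finite set $\mathcal V$ of variables that contains, for each variable $x$, a distinct differential variable $x'$ (no higher-order differentials). Function symbols $f$ and predicate symbols $p$ have arity $0$ or $1$; there is a reserved function symbol $\cdot$ of arity $0$; and there are game symbols $a$. Terms: $\theta,\eta::=x\mid f\mid f(\theta)\mid\theta+\eta\mid\theta\cdot\eta\mid(\theta)'$. Formulas: $\phi,\psi::=\theta\ge\eta\mid p\mid p(\theta)\mid\neg\phi\mid\phi\wedge\psi\mid\exists x\,\phi\mid\langle\alpha\rangle\phi$. Hybrid games: $\alpha,\beta::=a\mid x:=\theta\mid x'=\theta\,\&\,\psi\mid ?\psi\mid\alpha\cup\beta\mid\alpha;\beta\mid\alpha^*\mid\alpha^d$. In $x'=\theta\&\psi$, $x$ may be a vector of distinct variables and $\theta$ a matching vector of terms; then $\{x,x'\}$ denotes all these variables and their differential variables. Semantics. A state is a map $\omega:\mathcal V\to\mathbb R$, and $\mathcal S$ is the set of all states. An interpretation $I$ assigns to each function symbol a real number (arity 0) or a smooth function $\mathbb R\to\mathbb R$ (arity 1); to each predicate symbol a truth value (arity 0) or a subset of $\mathbb R$ (arity 1); and to each game symbol $a$ a monotone map $I(a):\mathcal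 P(\mathcal S)\to\mathcal P(\mathcal S)$. The value $I\omega[\![\theta]\!]$ is defined by: - $I\omega[\![x]\!]=\omega(x)$; - $I\omega[\![f(\theta)]\!]=I(f)(I\omega[\![\theta]\!])$; - sums and products are evaluated pointwise; - $I\omega[\![(\theta)']\!]=\sum_{x\in\mathcal V}\omega(x')\frac{\partial I\omega[\![\theta]\!]}{\partial x}$. Formulas denote sets $I[\![\phi]\!]\subseteq\mathcal S$ with the usual clauses for $\ge,p,\neg,\wedge$. A state is in $I[\![\exists x\phi]\!]$ iff some modification of its value of $x$ is in $I[\![\phi]\!]$. Finally $I[\![\langle\alpha\rangle\phi]\!]=\varsigma^I_\alpha(I[\![\phi]\!])$, where the winning region $\varsigma^I_\alpha(X)$ for $X\subseteq\mathcal S$ is: - $\varsigma^I_a(X)=I(a)(X)$; - $\varsigma^I_{x:=\theta}(X)=\{\omega:\omega[x\mapsto I\omega[\![\theta]\!]]\in X\}$; - $\varsigma^I_{x'=\theta\&\psi}(X)$ is the set of $\omega$ for which there are $r\ge0$ and $\varphi:[0,r]\to\mathcal S$ with: $\varphi(0)=\omega$ except on $x'$; $\varphi(r)\in X$; and for all $\zeta\in[0,r]$, $\varphi(\zeta)\in I[\![\psi]\!]$, $\varphi(\zeta)(x')=I\varphi(\zeta)[\![\theta]\!]$, $\varphi(\zeta)=\varphi(0)$ except on $\{x,x'\}$, and, if $r>0$, $\frac{d\varphi(t)(x)}{dt}(\zeta)$ exists and equals $\varphi(\zeta)(x')$; - $\varsigma^I_{?\psi}(X)=I[\![\psi]\!]\cap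 X$; - $\varsigma^I_{\alpha\cup\beta}(X)=\varsigma^I_\alpha(X)\cup\varsigma^I_\beta(X)$; - $\varsigma^I_{\alpha;\beta}(X)=\varsigma^I_\alpha(\varsigma^I_\beta(X))$; - $\varsigma^I_{\alpha^*}(X)=\bigcap\{Z: X\cup\varsigma^I_\alpha(Z)\subseteq Z\}$; - $\varsigma^I_{\alpha^d}(X)=\mathcal S\setminus\varsigma^I_\alpha(\mathcal S\setminus X)$. A formula $\phi$ is valid iff $I[\![\phi]\!]=\mathcal S$ for every interpretation $I$. Static semantics. $BV(\alpha)$ is the set of $x$ for which there exist $I,\omega,X$ with $\omega\in\varsigma^I_\alpha(X)$ but $\omega\notin\varsigma^I_\alpha(\{\nu\in X:\nu(x)=\omega(x)\})$. $FV(\theta)$ (resp. $FV(\phi)$) is the set of $x$ for which there are $I$ and states agreeing except on $x$ that give $\theta$ different values (resp. differ in membership in $I[\![\phi]\!]$). One-pass uniform substitution. A uniform substitution $\sigma$ maps finitely many function symbols to terms $\sigma f(\cdot)$ (arity 1; may mention the placeholder $\cdot$) or $\sigma f$ (arity 0), predicate symbols to formulas $\sigma p(\cdot)$ or $\sigma p$, and game symbols to games $\sigma a$. Other symbols are mapped to themselves. For $U\subseteq\mathcal V$, $\sigma^U(\theta)$, $\sigma^U(\phi)$, and games $\sigma^U_V(\alpha)$ with output taboo set $V$ are defined recursively as follows; the result is undefined if a side condition fails or a recursive call is undefined. Terms: - $\sigma^U(x)=x$; - $\sigma^U(f)=\sigma f$ if $FV(\sigma f)\cap U=\emptyset$; -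 $\sigma^U(f(\theta))=\{\cdot\mapsto\sigma^U(\theta)\}^{\emptyset}(\sigma f(\cdot))$ if $FV(\sigma f(\cdot))\cap U=\emptyset$; - $+$ and $\cdot$ are homomorphic; - $\sigma^U((\theta)')=(\sigma^{\mathcal V}(\theta))'$. Formulas: - $\sigma^U(\theta\ge\eta)=\sigma^U(\theta)\ge\sigma^U(\eta)$; - $\sigma^U(p)=\sigma p$ if $FV(\sigma p)\cap U=\emptyset$; - $\sigma^U(p(\theta))=\{\cdot\mapsto\sigma^U(\theta)\}^{\emptyset}(\sigma p(\cdot))$ if $FV(\sigma p(\cdot))\cap U=\emptyset$; - $\neg,\wedge$ are homomorphic; - $\sigma^U(\exists x\phi)=\exists x\,\sigma^{U\cup\{x\}}(\phi)$; - $\sigma^U(\langle\alpha\rangle\phi)=\langle\sigma^U_V(\alpha)\rangle\sigma^V(\phi)$. Games: - $\sigma^U_{U\cup BV(\sigma a)}(a)=\sigma a$; - $\sigma^U_{U\cup\{x\}}(x:=\theta)=(x:=\sigma^U(\theta))$; - $\sigma^U_{U\cup\{x,x'\}}(x'=\theta\&\psi)=(x'=\sigma^{U\cup\{x,x'\}}(\theta)\&\sigma^{U\cup\{x,x'\}}(\psi))$; - $\sigma^U_U(?\psi)=?\sigma^U(\psi)$; - $\sigma^U_{V\cup W}(\alpha\cup\beta)=\sigma^U_V(\alpha)\cup\sigma^U_W(\beta)$; - $\sigma^U_W(\alpha;\beta)=\sigma^U_V(\alpha);\sigma^V_W(\beta)$; - $\sigma^U_V(\alpha^* )=(\sigma^V_V(\alpha))^*$,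 where $\sigma^U_V(\alpha)$ must be defined; - $\sigma^U_V(\alpha^d)=(\sigma^U_V(\alpha))^d$. *)

(* Defs.v *)
From HB Require Import structures.
From mathcomp Require Import all_boot all_order all_algebra finmap.
From mathcomp Require Import all_classical all_reals all_analysis.
Set Implicit Arguments.
Unset Strict Implicit.
Unset Printing Implicit Defensive.
Import Order.TTheory GRing.Theory Num.Theory.
Import numFieldNormedType.Exports.
Local Open Scope classical_set_scope.
Local Open Scope ring_scope.

(* [sg_base] holds the variables that are not differential variables;
   [sg_dot] is the reserved placeholder symbol. *)
Record signature := Signature {
  sg_base : finType;
  sg_fun0 : choiceType;
  sg_dot : sg_fun0;
  sg_fun1 : choiceType;
  sg_prd0 : choiceType;
  sg_prd1 : choiceType;
  sg_game : choiceType
}.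

(* The finite set of all variables: [inl x] is x and [inr x] is its
   differential variable x'.  There is no x''. *)
Definition vars (S : signature) : finType := (sg_base S + sg_base S)%type.

Definition bvar (S : signature) (x : sg_base S) : vars S := inl x.
Definition dvar (S : signature) (x : sg_base S) : vars S := inr x.

Inductive term (S : signature) : Type :=
| TVar of vars S
| TFun0 of sg_fun0 S
| TFun1 of sg_fun1 S & term S
| TAdd of term S & term S
| TMul of term S & term S
| TDiff of term S.

Definition TDot (S : signature) : term S := TFun0 (sg_dot S).

(* The vectorial differential equation x' = theta: a nonempty vector of
   pairwise distinct variables with a matching vector of terms. *)
Record ode (S : signature) : Type := Ode {
  ode_dim : nat;
  ode_var : 'I_ode_dim.+1 -> sg_base S;
  ode_inj : injective ode_var;
  ode_rhs : 'I_ode_dim.+1 -> term S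
}.

Inductive formula (S : signature) : Type :=
| FGe of term S & term S
| FPrd0 of sg_prd0 S
| FPrd1 of sg_prd1 S & term S
| FNot of formula S
| FAnd of formula S & formula S
| FEx of vars S & formula S
| FDia of game S & formula S
with game (S : signature) : Type :=
| GSym of sg_game S
| GAsgn of vars S & term S
| GOde of ode S & formula S
| GTest of formula S
| GChoice of game S & game S
| GSeq of game S & game S
| GStar of game S
| GDual of game S.

Definition ode_primed (S : signature) (o : ode S) : {set vars S} :=
  [set dvar (ode_var i) | i : 'I_(ode_dim o).+1]%SET.

(* The set {x, x'} of a (vectorial) differential equation. *)
Definition ode_bound (S : signature) (o : ode S) : {set vars S} :=
  ([set bvar (ode_var i) | i : 'I_(ode_dim o).+1] :|: ode_primed o)%SET.

Section Semantics.
Variables (R : realType) (S : signature).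

Definition state := vars S -> R.

Definition upd (w : state) (x : vars S) (r : R) : state :=
  fun y => if y == x then r else w y.

Definition agree_off (U : {set vars S}) (w v : state) : Prop :=
  forall y, y \notin U -> w y = v y.

Definition smooth (f : R -> R) : Prop :=
  forall (n : nat) (x : R), derivable (f^`(n))%classic x 1.

(* The derivative of [f], relative to the set [D], exists at [z] and is [l];
   one-sided at the end points when [D] is a closed interval. *)
Definition is_derive_within (D : set R) (f : R -> R) (z l : R) : Prop :=
  (f t - f z) / (t - z) @[t --> within D z^'] --> l.

Record interp := Interp {
  i_fun0 : sg_fun0 S -> R;
  i_fun1 : sg_fun1 S -> R -> R;
  i_fun1_smooth : forall f, smooth (i_fun1 f);
  i_prd0 : sg_prd0 S -> Prop;
  i_prd1 : sg_prd1 S -> set R;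
  i_game : sg_game S -> set state -> set state;
  i_game_mono : forall a (X Y : set state),
    X `<=` Y -> i_game a X `<=` i_game a Y
}.

(* In a differential the sum ranges over the variables x for which there is an
   x'; so x' itself has differential 0. *)
Fixpoint sem_t (I : interp) (t : term S) (w : state) : R :=
  match t with
  | TVar x => w x
  | TFun0 f => i_fun0 I f
  | TFun1 f t1 => i_fun1 I f (sem_t I t1 w)
  | TAdd t1 t2 => sem_t I t1 w + sem_t I t2 w
  | TMul t1 t2 => sem_t I t1 w * sem_t I t2 w
  | TDiff t1 =>
      \sum_(x : sg_base S)
        w (dvar x) * derive1 (fun r : R => sem_t I t1 (upd w (bvar x) r)) (w (bvar x))
  end.

(* The trajectory [phi] of a differential equation is only constrained on
   [0, r]; its values elsewhere are irrelevant. *)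
Fixpoint sem_f (I : interp) (p : formula S) : set state :=
  match p with
  | FGe t1 t2 => [set w | sem_t I t1 w >= sem_t I t2 w]
  | FPrd0 q => [set w | i_prd0 I q]
  | FPrd1 q t => [set w | i_prd1 I q (sem_t I t w)]
  | FNot p1 => ~` sem_f I p1
  | FAnd p1 p2 => sem_f I p1 `&` sem_f I p2
  | FEx x p1 => [set w | exists r : R, sem_f I p1 (upd w x r)]
  | FDia a p1 => sem_g I a (sem_f I p1)
  end
with sem_g (I : interp) (a : game S) (X : set state) : set state :=
  match a with
  | GSym b => i_game I b X
  | GAsgn x t => [set w | X (upd w x (sem_t I t w))]
  | GOde o q => [set w | exists (r : R) (phi : R -> state),
      [/\ 0 <= r,
          agree_off (ode_primed o) (phi 0) w,
          X (phi r) &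
          forall z : R, 0 <= z <= r ->
            [/\ sem_f I q (phi z),
                forall i, phi z (dvar (ode_var i)) = sem_t I (ode_rhs (o := o) i) (phi z),
                agree_off (ode_bound o) (phi z) (phi 0) &
                0 < r -> forall i : 'I_(ode_dim o).+1,
                  is_derive_within [set` `[0, r]]
                    (fun t => phi t (bvar (ode_var i))) z
                    (phi z (dvar (ode_var i)))]]]
  | GTest q => sem_f I q `&` X
  | GChoice b c => sem_g I b X `|` sem_g I c X
  | GSeq b c => sem_g I b (sem_g I c X)
  | GStar b => \bigcap_(Z in [set Z | X `|` sem_g I b Z `<=` Z]) Z
  | GDual b => ~` sem_g I b (~` X)
  end.

Definition valid (p : formula S) : Prop :=
  forall I : interp, sem_f I p = setT.

Definition FVt (t : term S) : {set vars S} :=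
  [set x | `[< exists (I : interp) (w v : state),
    agree_off [set x]%SET w v /\ sem_t I t w <> sem_t I t v >]]%SET.

Definition FVf (p : formula S) : {set vars S} :=
  [set x | `[< exists (I : interp) (w v : state),
    [/\ agree_off [set x]%SET w v, sem_f I p w & ~ sem_f I p v] >]]%SET.

Definition BVg (a : game S) : {set vars S} :=
  [set x | `[< exists (I : interp) (w : state) (X : set state),
    sem_g I a X w /\
    ~ sem_g I a (X `&` (fun v : state => v x = w x)) w >]]%SET.

End Semantics.

(* Finite maps: a symbol outside the domain is mapped to itself.  The
   replacements of symbols of arity 1 may mention the placeholder [TDot S]. *)
Record usubst (S : signature) := USubst {
  us_fun0 : {fmap sg_fun0 S -> term S};
  us_fun1 : {fmap sg_fun1 S -> term S};
  us_prd0 : {fmap sg_prd0 S -> formula S};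
  us_prd1 : {fmap sg_prd1 S -> formula S};
  us_game : {fmap sg_game S -> game S}
}.

Section Substitution.
Variables (R : realType) (S : signature).
Implicit Types (s : usubst S) (U : {set vars S}).

Definition app_fun0 s (f : sg_fun0 S) : term S :=
  odflt (TFun0 f) (us_fun0 s).[? f]%fmap.
Definition app_prd0 s (q : sg_prd0 S) : formula S :=
  odflt (FPrd0 q) (us_prd0 s).[? q]%fmap.
Definition app_game s (b : sg_game S) : game S :=
  odflt (GSym b) (us_game s).[? b]%fmap.

(* The one-pass substitution, with [None] for an undefined result.  Replacing
   a symbol of arity 1 needs the substitution {. |-> t}, which is an instance of
   the function being defined and not a structurally smaller call.  Since
   {. |-> t} itself replaces no symbol of arity 1, the recursion is stratified:
   [instt e t] and [instf e t] stand for the result of applying {. |-> t} with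
   empty taboo to [e]; they are supplied below.  On a symbol f of arity 1 that
   is mapped to itself the result is f applied to the substituted argument; the
   side condition is void there, as f(.) has no free variable. *)
Section Stratum.
Variables (instt : term S -> term S -> option (term S))
          (instf : formula S -> term S -> option (formula S)).

Fixpoint usub_t_gen s U (t : term S) : option (term S) :=
  match t with
  | TVar x => Some (TVar x)
  | TFun0 f =>
      if [disjoint FVt R (app_fun0 s f) & U] then Some (app_fun0 s f) else None
  | TFun1 f t1 =>
      if usub_t_gen s U t1 is Some t1' then
        match (us_fun1 s).[? f]%fmap with
        | Some e => if [disjoint FVt R e & U] then instt e t1' else None
        | None => Some (TFun1 f t1')
        end
      else None
  | TAdd t1 t2 =>
      if (usub_t_gen s U t1, usub_t_gen s U t2) is (Some t1', Some t2')
      then Some (TAdd t1' t2') else None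
  | TMul t1 t2 =>
      if (usub_t_gen s U t1, usub_t_gen s U t2) is (Some t1', Some t2')
      then Some (TMul t1' t2') else None
  | TDiff t1 =>
      if usub_t_gen s [set: vars S]%SET t1 is Some t1'
      then Some (TDiff t1') else None
  end.

Definition usub_ode_gen s U (o : ode S) : option (ode S) :=
  if [forall i, isSome (usub_t_gen s U (ode_rhs (o := o) i))] then
    Some (Ode (@ode_inj S o)
      (fun i => odflt (ode_rhs i) (usub_t_gen s U (ode_rhs i))))
  else None.

(* On games the result is the pair of the output taboo and the substituted
   game. *)
Fixpoint usub_f_gen s U (p : formula S) : option (formula S) :=
  match p with
  | FGe t1 t2 =>
      if (usub_t_gen s U t1, usub_t_gen s U t2) is (Some t1', Some t2')
      then Some (FGe t1' t2') else None
  | FPrd0 q =>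
      if [disjoint FVf R (app_prd0 s q) & U] then Some (app_prd0 s q) else None
  | FPrd1 q t =>
      if usub_t_gen s U t is Some t' then
        match (us_prd1 s).[? q]%fmap with
        | Some e => if [disjoint FVf R e & U] then instf e t' else None
        | None => Some (FPrd1 q t')
        end
      else None
  | FNot p1 =>
      if usub_f_gen s U p1 is Some p1' then Some (FNot p1') else None
  | FAnd p1 p2 =>
      if (usub_f_gen s U p1, usub_f_gen s U p2) is (Some p1', Some p2')
      then Some (FAnd p1' p2') else None
  | FEx x p1 =>
      if usub_f_gen s (U :|: [set x])%SET p1 is Some p1'
      then Some (FEx x p1') else None
  | FDia a p1 =>
      if usub_g_gen s U a is Some (V, a') then
        if usub_f_gen s V p1 is Some p1' then Some (FDia a' p1') else None
      else None
  end
with usub_g_gen s U (a : game S) : option ({set vars S} * game S) :=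
  match a with
  | GSym b => Some ((U :|: BVg R (app_game s b))%SET, app_game s b)
  | GAsgn x t =>
      if usub_t_gen s U t is Some t'
      then Some ((U :|: [set x])%SET, GAsgn x t') else None
  | GOde o q =>
      let V := (U :|: ode_bound o)%SET in
      if (usub_ode_gen s V o, usub_f_gen s V q) is (Some o', Some q')
      then Some (V, GOde o' q') else None
  | GTest q =>
      if usub_f_gen s U q is Some q' then Some (U, GTest q') else None
  | GChoice b c =>
      if (usub_g_gen s U b, usub_g_gen s U c) is (Some (V, b'), Some (W, c'))
      then Some ((V :|: W)%SET, GChoice b' c') else None
  | GSeq b c =>
      if usub_g_gen s U b is Some (V, b') then
        if usub_g_gen s V c is Some (W, c') then Some (W, GSeq b' c') else None
      else None
  | GStar b =>
      if usub_g_gen s U b is Some (V, _) then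
        if usub_g_gen s V b is Some (W, b') then
          if W == V then Some (V, GStar b') else None
        else None
      else None
  | GDual b =>
      if usub_g_gen s U b is Some (V, b') then Some (V, GDual b') else None
  end.

End Stratum.

Definition dot_subst (t : term S) : usubst S :=
  USubst [fmap].[sg_dot S <- t]%fmap [fmap]%fmap [fmap]%fmap [fmap]%fmap
    [fmap]%fmap.

Definition dot_t (e t : term S) : option (term S) :=
  usub_t_gen (fun _ _ => None) (dot_subst t) finset.set0 e.

Definition dot_f (e : formula S) (t : term S) : option (formula S) :=
  usub_f_gen (fun _ _ => None) (fun _ _ => None) (dot_subst t) finset.set0 e.

Definition usub_t := usub_t_gen dot_t.
Definition usub_f := usub_f_gen dot_t dot_f.
Definition usub_g := usub_g_gen dot_t dot_f.

End Substitution.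

Scheme formula_game_ind := Induction for formula Sort Prop
with game_formula_ind := Induction for game Sort Prop.
Combined Scheme formula_game_mutind from formula_game_ind, game_formula_ind.

(* The stratification is harmless: [dot_t] and [dot_f] are the one-pass
   substitution {. |-> t} with empty taboo. *)
Section DotSubstitution.
Variables (R : realType) (S : signature).

Lemma usub_t_gen_dot (i j : term S -> term S -> option (term S)) t U e :
  usub_t_gen R i (dot_subst t) U e = usub_t_gen R j (dot_subst t) U e.
Proof.
elim: e U => //= [f e IH|e1 IH1 e2 IH2|e1 IH1 e2 IH2|e IH] U.
- by rewrite IH fnd_fmap0.
- by rewrite IH1 IH2.
- by rewrite IH1 IH2.
- by rewrite IH.
Qed.

Lemma usub_fg_gen_dot (i j : term S -> term S -> option (term S))
    (k l : formula S -> term S -> option (formula S)) t :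
  (forall p U, usub_f_gen R i k (dot_subst t) U p =
     usub_f_gen R j l (dot_subst t) U p) /\
  (forall a U, usub_g_gen R i k (dot_subst t) U a =
     usub_g_gen R j l (dot_subst t) U a).
Proof.
have E := usub_t_gen_dot i j t.
apply: formula_game_mutind => /=.
- by move=> t1 t2 U; rewrite !E.
- by [].
- by move=> q t1 U; rewrite !E fnd_fmap0.
- by move=> p IH U; rewrite IH.
- by move=> p1 IH1 p2 IH2 U; rewrite IH1 IH2.
- by move=> x p IH U; rewrite IH.
- by move=> a IHa p IH U; rewrite IHa; case: usub_g_gen => // -[V a']; rewrite IH.
- by [].
- by move=> x t1 U; rewrite !E.
- move=> o q IH U; rewrite IH; suff -> : forall V,
    usub_ode_gen R i (dot_subst t) V o = usub_ode_gen R j (dot_subst t) V o by [].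
  move=> V; rewrite /usub_ode_gen; under eq_forallb do rewrite E.
  by case: ifP => // _; congr (Some (Ode _ _)); apply/funext => m; rewrite E.
- by move=> q IH U; rewrite IH.
- by move=> b IHb c IHc U; rewrite IHb IHc.
- by move=> b IHb c IHc U; rewrite IHb; case: usub_g_gen => // -[V b']; rewrite IHc.
- by move=> b IHb U; rewrite IHb; case: usub_g_gen => // -[V b']; rewrite IHb.
- by move=> b IHb U; rewrite IHb.
Qed.

Lemma dot_tE (e t : term S) : dot_t R e t = usub_t R (dot_subst t) finset.set0 e.
Proof. exact: usub_t_gen_dot. Qed.

Lemma dot_fE (e : formula S) (t : term S) :
  dot_f R e t = usub_f R (dot_subst t) finset.set0 e.
Proof. by rewrite /dot_f (usub_fg_gen_dot _ (@dot_t R S) _ (@dot_f R S) t).1. Qed.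

End DotSubstitution.

(* Main.v *)
Require Import Defs.
From HB Require Import structures.
From mathcomp Require Import all_boot all_order all_algebra finmap.
From mathcomp Require Import all_classical all_reals all_analysis.

Set Implicit Arguments.
Unset Strict Implicit.
Unset Printing Implicit Defensive.
Import Order.TTheory GRing.Theory Num.Theory.
Import numFieldNormedType.Exports.
Local Open Scope classical_set_scope.
Local Open Scope ring_scope.

(** A substitution is turned into the adjoint interpretation of [I] at a state
  [w]: it reads every symbol as the meaning of its replacement, evaluated at [w].
  If [v] differs from [w] only on the taboo [U], then the substituted expression
  at [v] has the value of the original expression at [v] in the adjoint
  interpretation at [w]; this goes through because replacements have no free
  variable in [U], and because a game only changes the variables of its output
  taboo.  Validity of [phi] in the adjoint interpretations is then validity of
  the substituted formula.  The adjoint interpretation of a unary function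
  symbol has to be smooth in the placeholder: since symbols are at most unary,
  it is enough to know that term values have iterated partial derivatives of all
  orders, which needs the one-dimensional rules only. *)

(** * Iterated partial derivatives *)

Section PartialDerivatives.
Variables (R : realType) (T : eqType).
Implicit Types (F G : (T -> R) -> R) (e : T -> R) (g : R -> R).

(** Coordinates are indexed by an arbitrary [T], so that the placeholder can later be one more
    coordinate beside the variables. *)
Definition set_coord e (x : T) (r : R) : T -> R :=
  fun y => if y == x then r else e y.

Lemma set_coord_id e x : set_coord e x (e x) = e.
Proof. by apply/funext => y; rewrite /set_coord; case: eqP => // ->. Qed.

Lemma set_coord_set e x r q : set_coord (set_coord e x r) x q = set_coord e x q.
Proof. by apply/funext => y; rewrite /set_coord; case: eqP. Qed.

Lemma set_coordxx e x r : set_coord e x r x = r.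
Proof. by rewrite /set_coord eqxx. Qed.

Definition partial x F : (T -> R) -> R :=
  fun e => derive1 (fun r => F (set_coord e x r)) (e x).

Definition has_partial x F : Prop :=
  forall e, derivable (fun r => F (set_coord e x r)) (e x) 1.

(* The partial derivatives are not required to be continuous. *)
Fixpoint pdiff n F : Prop :=
  if n is m.+1 then forall x, has_partial x F /\ pdiff m (partial x F) else True.

Lemma pdiffW n F : pdiff n.+1 F -> pdiff n F.
Proof.
elim: n F => [//|n IH] F HF x; have [dF pF] := HF x.
by split; [exact: dF|exact: IH].
Qed.

Lemma pdiff_cst n c : pdiff n (fun=> c).
Proof.
elim: n c => [//|n IH] c x; split; first by move=> e; exact: derivable_cst.
suff -> : partial x (fun=> c) = fun=> 0 by exact: IH.
by apply/funext => e; rewrite /partial derive1_cst.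
Qed.

Lemma pdiff_coord n y : pdiff n (fun e => e y).
Proof.
case: n => [//|n] x.
have [->|yx] := eqVneq y x.
  have E e : (fun r => set_coord e x r x) = id.
    by apply/funext => r; rewrite set_coordxx.
  split; first by move=> e; rewrite E; exact: derivable_id.
  suff -> : partial x (fun e => e x) = fun=> 1 by exact: pdiff_cst.
  by apply/funext => e; rewrite /partial E derive1_id.
have E e : (fun r => set_coord e x r y) = fun=> e y.
  by apply/funext => r; rewrite /set_coord (negbTE yx).
split; first by move=> e; rewrite E; exact: derivable_cst.
suff -> : partial x (fun e => e y) = fun=> 0 by exact: pdiff_cst.
by apply/funext => e; rewrite /partial E derive1_cst.
Qed.

Lemma pdiffD n F G : pdiff n F -> pdiff n G -> pdiff n (fun e => F e + G e).
Proof.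
elim: n F G => [//|n IH] F G HF HG x.
have [dF pF] := HF x; have [dG pG] := HG x.
split; first by move=> e; exact: derivableD (dF e) (dG e).
suff -> : partial x (fun e => F e + G e) =
    fun e => partial x F e + partial x G e by exact: IH.
apply/funext => e; rewrite /partial !derive1E.
exact: deriveD (dF e) (dG e).
Qed.

Lemma pdiffM n F G : pdiff n F -> pdiff n G -> pdiff n (fun e => F e * G e).
Proof.
elim: n F G => [//|n IH] F G HF HG x.
have [dF pF] := HF x; have [dG pG] := HG x.
split; first by move=> e; exact: derivableM (dF e) (dG e).
suff -> : partial x (fun e => F e * G e) =
    fun e => F e * partial x G e + G e * partial x F e.
  by apply: pdiffD; apply: IH => //; apply: pdiffW.
apply/funext => e; rewrite /partial !derive1E.
have := deriveM (dF e) (dG e).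
by rewrite /= set_coord_id.
Qed.

Lemma pdiff_sum n (J : Type) (s : seq J) (F : J -> (T -> R) -> R) :
  (forall j, pdiff n (F j)) -> pdiff n (fun e => \sum_(j <- s) F j e).
Proof.
move=> HF; elim: s => [|j s IH].
  by under eq_fun do rewrite big_nil; exact: pdiff_cst.
by under eq_fun do rewrite big_cons; exact: pdiffD.
Qed.

Lemma smooth_derive1 g : smooth g -> smooth (g^`())%classic.
Proof. by move=> sg n r; rewrite -derive1Sn; exact: sg. Qed.

(** By the chain rule a partial derivative of the composite is a product of [g'(F)] and a partial
    derivative of [F]; as [g'] is again smooth, the induction on the order runs over all [g] and
    [F]. *)
Lemma pdiff_comp n g F : smooth g -> pdiff n F -> pdiff n (fun e => g (F e)).
Proof.
elim: n g F => [//|n IH] g F sg HF x; have [dF pF] := HF x.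
have dg e : derivable g (F (set_coord e x (e x))) 1 by exact: (sg 0).
split; first by move=> e; apply/derivable1_diffP;
  apply: differentiable_comp; apply/derivable1_diffP.
suff -> : partial x (fun e => g (F e)) =
    fun e => derive1 g (F e) * partial x F e.
  apply: pdiffM => //; apply: IH; first exact: smooth_derive1.
  exact: pdiffW.
apply/funext => e; rewrite /partial.
have := derive1_comp (dF e) (dg e).
by rewrite /= set_coord_id.
Qed.

(** Differentiating the restriction of [F] to a coordinate line gives the restriction of a partial
    derivative. *)
Lemma smooth_coord F e x : (forall n, pdiff n F) ->
  smooth (fun r => F (set_coord e x r)).
Proof.
(* Derivability of the [n]-th derivative takes order [n.+1]. *)
move=> HF n; have {HF} := HF n.+1.
have slice G : (derive1 (fun r => G (set_coord e x r))) =
    fun r => partial x G (set_coord e x r).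
  apply/funext => r; rewrite /partial set_coordxx.
  by under [in RHS]eq_fun do rewrite set_coord_set.
elim: n F => [|n IH] F HF r; have [dF pF] := HF x.
  have := dF (set_coord e x r); rewrite set_coordxx.
  by under eq_fun do rewrite set_coord_set.
by rewrite derive1Sn slice; exact: IH.
Qed.

End PartialDerivatives.

Section Adjoint.
Variables (R : realType) (S : signature).
Implicit Types (I : interp R S) (w v : state R S) (U V : {set vars S}).
Implicit Types (t e : term S) (p q : formula S) (a b c : game S).
Implicit Types (X Y Z : set (state R S)) (s : usubst S).

(** * Static semantics *)

Lemma agree_off_sub U V w v : U \subset V -> agree_off U w v -> agree_off V w v.
Proof.
by move=> /fintype.subsetP UV wv y yV; apply: wv; apply: contra yV; exact: UV.
Qed.

Lemma agree_off_trans U w v u :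
  agree_off U w v -> agree_off U v u -> agree_off U w u.
Proof. by move=> wv vu y yU; rewrite wv// vu. Qed.

Lemma agree_off_sym U w v : agree_off U w v -> agree_off U v w.
Proof. by move=> wv y yU; rewrite wv. Qed.

Lemma agree_off_refl U w : agree_off U w w.
Proof. by []. Qed.

Lemma agree_off_upd w x r : agree_off [set x]%SET (upd w x r) w.
Proof. by move=> y; rewrite inE /upd => /negbTE ->. Qed.

(** Free variables are defined by changing one variable at a time, so [w] is turned into [v] by
    running through the finite set [U]. *)
Lemma coincidence (T : Type) (f : state R S -> T) U w v :
  (forall x, x \in U -> forall w v, agree_off [set x]%SET w v -> f w = f v) ->
  agree_off U w v -> f w = f v.
Proof.
move=> Hf wv; have {wv} : forall y, y \notin enum U -> w y = v y.
  by move=> y; rewrite mem_enum; exact: wv.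
have {Hf} : forall x, x \in enum U ->
    forall w v, agree_off [set x]%SET w v -> f w = f v.
  by move=> x; rewrite mem_enum; exact: Hf.
elim: (enum U) w => [|x l IH] w Hf wv.
  by congr f; apply/funext => y; exact: wv.
rewrite -(Hf x (mem_head _ _) _ _ (@agree_off_upd w x (v x))).
apply: IH => [y yl|y yl]; first by apply: Hf; rewrite inE yl orbT.
rewrite /upd; case: (eqVneq y x) => [->//|yx].
by apply: wv; rewrite inE negb_or yx.
Qed.

Lemma coincidence_t I t U w v :
  [disjoint FVt R t & U]%B -> agree_off U w v -> sem_t I t w = sem_t I t v.
Proof.
move=> dis; apply: coincidence => x xU w1 v1 wv.
have : x \notin FVt R t by rewrite (disjointFl dis xU).
by rewrite inE => /asboolPn nx; apply: contrapT => ne; apply: nx; exists I, w1, v1.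
Qed.

Lemma coincidence_f I p U w v :
  [disjoint FVf R p & U]%B -> agree_off U w v -> sem_f I p w = sem_f I p v.
Proof.
move=> dis; apply: coincidence => x xU w1 v1 wv.
have : x \notin FVf R p by rewrite (disjointFl dis xU).
rewrite inE => /asboolPn nx.
apply/propext; split => ?; apply: contrapT => ne; apply: nx.
  by exists I, w1, v1.
by exists I, v1, w1; split => //; exact: agree_off_sym.
Qed.

Lemma sem_g_mono I a X Y : X `<=` Y -> sem_g I a X `<=` sem_g I a Y.
Proof.
elim: a X Y => /= [b|x t|o q|q|b IHb c IHc|b IHb c IHc|b IHb|b IHb] X Y XY.
- exact: i_game_mono.
- by move=> w; exact: XY.
- by move=> w [r [phi [r0 phi0 /XY Xr H]]]; exists r, phi.
- by move=> w [? /XY].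
- by move=> w [/(IHb _ _ XY)|/(IHc _ _ XY)]; [left|right].
- by apply: IHb; exact: IHc.
- move=> w Hw Z /= HZ; apply: Hw => /= v [/XY Yv|bZ]; apply: HZ; [by left|by right].
- by move=> w; apply: contra_not; apply: IHb => v /=; apply: contra_not; exact: XY.
Qed.

(** [BVg] tests one variable at a time; here the goal is restricted on all variables outside [V] at
    once, a form that passes through the game constructors. *)
Definition bound_in V a : Prop := forall I X w,
  sem_g I a X w -> sem_g I a (X `&` [set v | agree_off V v w]) w.

Lemma bound_in_eq V a I X Y w : bound_in V a ->
  (forall v, agree_off V v w -> X v = Y v) -> sem_g I a X w = sem_g I a Y w.
Proof.
move=> aV XY; apply/propext; split => /aV; apply: sem_g_mono => v [Hv vw].
  by rewrite -XY.
by rewrite XY.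
Qed.

Lemma bound_in_sub U V a : U \subset V -> bound_in U a -> bound_in V a.
Proof.
move=> UV aU I X w /aU; apply: sem_g_mono => v [Xv vw]; split => //.
exact: agree_off_sub vw.
Qed.

Lemma bound_in_BVg a : bound_in (BVg R a) a.
Proof.
move=> I X w Hw.
suff : sem_g I a
    (X `&` [set v | forall y, y \in enum (~: BVg R a) -> v y = w y]) w.
  apply: sem_g_mono => v [Xv vw]; split => // y yB; apply: vw.
  by rewrite mem_enum inE.
have : {subset enum (~: BVg R a) <= ~: BVg R a}.
  by move=> y; rewrite mem_enum.
elim: (enum _) => [|x l IH] sl.
  by apply: sem_g_mono Hw => v Xv; split.
have {}IH := IH (fun y yl => sl y (mem_behead (s := x :: l) yl)).
have : x \notin BVg R a by have := sl x (mem_head _ _); rewrite inE.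
rewrite inE => /asboolPn nx; apply: contrapT => nH; apply: nx.
(* If fixing [x] as well failed, the goal already restricted by the induction hypothesis would
   witness that [x] is bound. *)
do 3 eexists; split; first exact: IH.
apply: contra_not nH; apply: sem_g_mono => v [[Xv vl] vx]; split => // y.
by rewrite inE => /predU1P[->|/vl].
Qed.

Lemma bound_in_asgn x t : bound_in [set x]%SET (GAsgn x t).
Proof. by move=> I X w /= Xw; split => //; exact: agree_off_upd. Qed.

Lemma ode_primed_sub (o : ode S) : ode_primed o \subset ode_bound o.
Proof. exact: finset.subsetUr. Qed.

Lemma bound_in_ode o q : bound_in (ode_bound o) (GOde o q).
Proof.
move=> I X w /= [r [phi [r0 phi0 Xr H]]]; exists r, phi; split => //; split => //=.
have [|_ _ Hr _] := H r; first by rewrite r0 lexx.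
apply: agree_off_trans Hr _; apply: agree_off_sub phi0; exact: ode_primed_sub.
Qed.

Lemma bound_in_test V q : bound_in V (GTest q).
Proof. by move=> I X w [qw Xw]. Qed.

Lemma bound_in_choice V b c :
  bound_in V b -> bound_in V c -> bound_in V (GChoice b c).
Proof. by move=> Hb Hc I X w /= [/Hb|/Hc]; [left|right]. Qed.

Lemma bound_in_seq V b c : bound_in V b -> bound_in V c -> bound_in V (GSeq b c).
Proof.
move=> Hb Hc I X w /= /Hb; apply: sem_g_mono => v [/Hc + vw].
apply: sem_g_mono => u [Xu uv]; split => //=; exact: agree_off_trans vw.
Qed.

Lemma bound_in_star V b : bound_in V b -> bound_in V (GStar b).
Proof.
move=> Hb I X w /= Hw Z /= HZ.
(* This set is a prefixpoint: a round from a state agreeing with [w] off [V] can be made to end in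
   such states. *)
apply: (Hw [set v | agree_off V v w -> Z v]) => //=.
move=> v [Xv vw|/Hb bv vw]; apply: HZ; [by left|right].
apply: sem_g_mono bv => u [Zu uv]; apply: Zu; exact: agree_off_trans vw.
Qed.

(** Among states agreeing with [w] off [V], missing the restricted goal amounts to missing [X]. *)
Lemma bound_in_dual V b : bound_in V b -> bound_in V (GDual b).
Proof.
move=> Hb I X w /=; apply: contra_not => /Hb; apply: sem_g_mono => v [nX vw] Xv.
exact: nX.
Qed.

(** * Adjoint interpretations *)

Definition interp_dot I (r : R) : interp R S :=
  Interp (fun f => if f == sg_dot S then r else i_fun0 I f)
    (@i_fun1_smooth _ _ I) (i_prd0 I) (i_prd1 I) (@i_game_mono _ _ I).

(* The placeholder is the coordinate [None]. *)
Lemma pdiff_sem_t I t n : pdiff n (fun e : option (vars S) -> R =>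
  sem_t (interp_dot I (e None)) t (fun x => e (Some x))).
Proof.
elim: t n => /= [x|f|f t IH|t1 IH1 t2 IH2|t1 IH1 t2 IH2|t IH] n.
- exact: pdiff_coord.
- by case: eqP => _; [exact: pdiff_coord|exact: pdiff_cst].
- exact: pdiff_comp (@i_fun1_smooth _ _ I f) (IH n).
- exact: pdiffD.
- exact: pdiffM.
- apply: pdiff_sum => x; apply: pdiffM; first exact: pdiff_coord.
  (* Order [n] of a differential takes order [n.+1] of the term under it. *)
  by have [_] := IH n.+1 (Some (bvar x)).
Qed.

Lemma smooth_sem_t I t w : smooth (fun r => sem_t (interp_dot I r) t w).
Proof.
(* The value 0 at the placeholder is a default that [set_coord] overwrites. *)
pose e0 (x : option (vars S)) := if x is Some y then w y else 0 : R.
exact: (@smooth_coord _ _ _ e0 None (pdiff_sem_t I t)).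
Qed.

Definition adjoint_fun1 s I w (f : sg_fun1 S) : R -> R :=
  if (us_fun1 s).[? f]%fmap is Some e
  then fun r => sem_t (interp_dot I r) e w else i_fun1 I f.

Lemma adjoint_fun1_smooth s I w f : smooth (adjoint_fun1 s I w f).
Proof.
rewrite /adjoint_fun1; case: fnd => [e|]; first exact: smooth_sem_t.
exact: i_fun1_smooth.
Qed.

Definition adjoint_prd1 s I w (q : sg_prd1 S) : set R :=
  if (us_prd1 s).[? q]%fmap is Some e
  then [set r | sem_f (interp_dot I r) e w] else i_prd1 I q.

(** Game symbols are read independently of [w]; their monotonicity is that of winning regions. *)
Definition adjoint s I w : interp R S :=
  Interp (fun f => sem_t I (app_fun0 s f) w) (@adjoint_fun1_smooth s I w)
    (fun q : sg_prd0 S => sem_f I (app_prd0 s q) w) (adjoint_prd1 s I w)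
    (fun b : sg_game S => @sem_g_mono I (app_game s b)).

Lemma interp_ext I I' : i_fun0 I = i_fun0 I' -> i_fun1 I = i_fun1 I' ->
  i_prd0 I = i_prd0 I' -> i_prd1 I = i_prd1 I' -> i_game I = i_game I' -> I = I'.
Proof.
case: I I' => [f0 f1 sf p0 p1 g mg] [f0' f1' sf' p0' p1' g' mg'] /=.
move=> E0 E1 E2 E3 E4; subst.
by rewrite (Prop_irrelevance sf sf') (Prop_irrelevance mg mg').
Qed.

(** This turns the substitution lemma for the placeholder into the statement needed for symbols of
    arity 1. *)
Lemma adjoint_dot t I w : adjoint (dot_subst t) I w = interp_dot I (sem_t I t w).
Proof.
apply: interp_ext => //=.
- apply/funext => f; rewrite /app_fun0 /= fnd_set.
  by case: eqP => // _; rewrite fnd_fmap0.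
- by apply/funext => f; rewrite /adjoint_fun1 /= fnd_fmap0.
- by apply/funext => q; rewrite /app_prd0 /= fnd_fmap0.
- by apply/funext => q; rewrite /adjoint_prd1 /= fnd_fmap0.
- by apply/funext => b; rewrite /app_game /= fnd_fmap0.
Qed.

(** * The substitution lemma *)

Section Stratum.
Variables (instt : term S -> term S -> option (term S))
          (instf : formula S -> term S -> option (formula S)).
(** Correctness of instantiating the placeholder is assumed, so that the substitution lemma can be
    used twice: first for [dot_subst t], then for any substitution. *)
Hypothesis insttP : forall e t e' I w, instt e t = Some e' ->
  sem_t I e' w = sem_t (interp_dot I (sem_t I t w)) e w.
Hypothesis instfP : forall p t p' I w, instf p t = Some p' ->
  sem_f I p' w = sem_f (interp_dot I (sem_t I t w)) p w.
Variable s : usubst S.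

Lemma usub_t_genP t U t' I v w : usub_t_gen R instt s U t = Some t' ->
  agree_off U v w -> sem_t I t' v = sem_t (adjoint s I w) t v.
Proof.
elim: t U t' v => /= [x|f|f t IH|t1 IH1 t2 IH2|t1 IH1 t2 IH2|t IH] U t' v.
- by case=> <-.
- by case: ifP => // dis [<-]; exact: coincidence_t.
- case E: usub_t_gen => [t1|//]; rewrite /adjoint_fun1.
  case: fnd => [e|[<-] vw] /=; last by rewrite (IH _ _ _ E vw).
  case: ifP => // dis /insttP -> vw; rewrite -(IH _ _ _ E vw).
  exact: coincidence_t vw.
- case E1: usub_t_gen => [t1'|//]; case E2: usub_t_gen => [t2'|//] [<-] vw /=.
  by rewrite (IH1 _ _ _ E1 vw) (IH2 _ _ _ E2 vw).
- case E1: usub_t_gen => [t1'|//]; case E2: usub_t_gen => [t2'|//] [<-] vw /=.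
  by rewrite (IH1 _ _ _ E1 vw) (IH2 _ _ _ E2 vw).
- case E: usub_t_gen => [t1|//] [<-] vw /=; apply: eq_bigr => x _.
  congr (_ * _); congr (derive1 _ _); apply/funext => r.
  (* Under a differential every variable is taboo, so the shifted state needs no agreement with
     [w]. *)
  by apply: IH E _ => y; rewrite inE.
Qed.

Lemma usub_ode_genP U (o : ode S) o' : usub_ode_gen R instt s U o = Some o' ->
  exists rhs, o' = Ode (@ode_inj S o) rhs /\
    forall I i v w, agree_off U v w ->
      sem_t I (rhs i) v = sem_t (adjoint s I w) (ode_rhs i) v.
Proof.
rewrite /usub_ode_gen; case: ifP => // /forallP H [<-]; eexists; split => // I i v w.
by have := H i; case E: usub_t_gen => [t|//] _; exact: usub_t_genP E.
Qed.

(** The same trajectory serves both sides: it changes only bound variables, which are taboo, so all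
    its states agree with [w] off [U]. *)
Lemma sem_g_ode_adjoint U (o : ode S) rhs q q' I X v w :
  ode_bound o \subset U ->
  (forall i v w, agree_off U v w ->
    sem_t I (rhs i) v = sem_t (adjoint s I w) (ode_rhs i) v) ->
  (forall v w, agree_off U v w -> sem_f I q' v = sem_f (adjoint s I w) q v) ->
  agree_off U v w ->
  sem_g I (GOde (Ode (@ode_inj S o) rhs) q') X v =
  sem_g (adjoint s I w) (GOde o q) X v.
Proof.
move=> oU Hrhs Hq vw.
have in_taboo (phi : R -> state R S) z : agree_off (ode_primed o) (phi 0) v ->
    agree_off (ode_bound o) (phi z) (phi 0) -> agree_off U (phi z) w.
  move=> phi0 phiz; apply: agree_off_trans vw.
  apply: agree_off_sub oU _; apply: agree_off_trans phiz _.
  exact: agree_off_sub (ode_primed_sub o) phi0.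
apply/propext; split => -[r [phi [r0 phi0 Xr H]]]; exists r, phi; split => // z zr;
  have [Hqz Hz phiz dz] := H z zr; have pw := in_taboo _ _ phi0 phiz; split => //.
- by rewrite -Hq.
- by move=> i; rewrite -Hrhs // -Hz.
- by rewrite (Hq _ _ pw).
- by move=> i; rewrite (Hrhs _ _ _ pw) -Hz.
Qed.

Lemma sem_g_starE b I X w : sem_g I (GStar b) X w =
  forall Z, X `|` sem_g I b Z `<=` Z -> Z w.
Proof. by []. Qed.

(** The two one-round operators are known to coincide only at states agreeing with [w] off [V], so
    prefixpoints are relativized to these states. *)
Lemma sem_g_star_adjoint V b b' I X v w : bound_in V b' ->
  (forall X v, agree_off V v w ->
    sem_g I b' X v = sem_g (adjoint s I w) b X v) ->
  agree_off V v w ->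
  sem_g I (GStar b') X v = sem_g (adjoint s I w) (GStar b) X v.
Proof.
move=> bV Hb vw.
have down Z u : agree_off V u w ->
    sem_g I b' [set x | agree_off V x w -> Z x] u -> sem_g I b' Z u.
  move=> uw /bV; apply: sem_g_mono => x [Zx xu]; apply: Zx.
  exact: agree_off_trans xu uw.
rewrite !sem_g_starE; apply/propext; split => Hv Z HZ;
  apply: (Hv [set u | agree_off V u w -> Z u]) => // u [Xu|bu] uw;
  apply: HZ; (try by left); right.
  by rewrite -Hb //; exact: down.
by apply: down => //; rewrite Hb.
Qed.

(** The bound on [a'] is proved along with its meaning, since it controls the states at which the
    rest of the formula or game is evaluated. *)
Lemma usub_fg_genP :
  (forall p U p', usub_f_gen R instt instf s U p = Some p' ->
    forall I v w, agree_off U v w ->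
      sem_f I p' v = sem_f (adjoint s I w) p v) /\
  (forall a U V a', usub_g_gen R instt instf s U a = Some (V, a') ->
    [/\ U \subset V, bound_in V a' &
      forall I X v w, agree_off U v w ->
        sem_g I a' X v = sem_g (adjoint s I w) a X v]).
Proof.
apply: formula_game_mutind => /=.
- move=> t1 t2 U p'; case E1: usub_t_gen => [t1'|//].
  case E2: usub_t_gen => [t2'|//] [<-] I v w vw /=.
  by rewrite (usub_t_genP I E1 vw) (usub_t_genP I E2 vw).
- by move=> q U p'; case: ifP => // dis [<-] I v w vw; exact: coincidence_f vw.
- move=> q t U p'; case E: usub_t_gen => [t'|//].
  rewrite /adjoint_prd1; case: fnd => [e|[<-] I v w vw] /=.
    case: ifP => // dis /instfP H I v w vw; rewrite H (usub_t_genP I E vw) /=.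
    exact: coincidence_f vw.
  by rewrite (usub_t_genP I E vw).
- move=> p IH U p'; case E: usub_f_gen => [p1|//] [<-] I v w vw /=.
  by rewrite /setC /= (IH _ _ E _ _ _ vw).
- move=> p1 IH1 p2 IH2 U p'; case E1: usub_f_gen => [p1'|//].
  case E2: usub_f_gen => [p2'|//] [<-] I v w vw /=.
  by rewrite /setI /= (IH1 _ _ E1 _ _ _ vw) (IH2 _ _ E2 _ _ _ vw).
- move=> x p IH U p'; case E: usub_f_gen => [p1|//] [<-] I v w vw /=.
  apply: eq_exists => r; apply: (IH _ _ E) => y.
  rewrite !inE negb_or => /andP[yU yx]; rewrite /upd (negbTE yx); exact: vw.
- move=> a IHa p IH U p'; case E: usub_g_gen => [[V a']|//].
  case E1: usub_f_gen => [p1|//] [<-] I v w vw /=.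
  have [UV aV Ha] := IHa _ _ _ E; rewrite -(Ha _ _ _ _ vw).
  (* States reached from [v] differ from [w] only on [V], the taboo with which the postcondition was
     substituted. *)
  apply: bound_in_eq aV _ => u uv; apply: (IH _ _ E1).
  by apply: agree_off_trans uv _; exact: agree_off_sub vw.
- move=> b U V a' [<- <-]; split => //; first exact: finset.subsetUl.
  exact: bound_in_sub (finset.subsetUr _ _) (@bound_in_BVg _).
- move=> x t U V a'; case E: usub_t_gen => [t'|//] [<- <-]; split.
  + exact: finset.subsetUl.
  + exact: bound_in_sub (finset.subsetUr _ _) (@bound_in_asgn _ _).
  + by move=> I X v w vw /=; rewrite (usub_t_genP I E vw).
- move=> o q IH U V a'; case E: usub_ode_gen => [ o'|//].
  case Eq: usub_f_gen => [q'|//] [<- <-]; split.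
  + exact: finset.subsetUl.
  + have [? [-> _]] := usub_ode_genP E.
    exact: bound_in_sub (finset.subsetUr _ _) (@bound_in_ode _ _).
  + move=> I X v w vw; have [rhs [-> Hrhs]] := usub_ode_genP E.
    apply: (sem_g_ode_adjoint _ _ (Hrhs I)); first exact: finset.subsetUr.
      by move=> u u' uu; exact: (IH _ _ Eq).
    exact: agree_off_sub (finset.subsetUl _ _) vw.
- move=> q IH U V a'; case E: usub_f_gen => [q'|//] [<- <-]; split => //.
    exact: bound_in_test.
  by move=> I X v w vw /=; rewrite /setI /= (IH _ _ E _ _ _ vw).
- move=> b IHb c IHc U V a'; case Eb: usub_g_gen => [[Vb b']|//].
  case Ec: usub_g_gen => [[Vc c']|//] [<- <-].
  have [Ub bV Hb] := IHb _ _ _ Eb; have [Uc cV Hc] := IHc _ _ _ Ec; split.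
  + exact: fintype.subset_trans Ub (finset.subsetUl _ _).
  + by apply: bound_in_choice; [exact: bound_in_sub (finset.subsetUl _ _) bV|
      exact: bound_in_sub (finset.subsetUr _ _) cV].
  + by move=> I X v w vw; rewrite /= /setU /= (Hb _ _ _ _ vw) (Hc _ _ _ _ vw).
- move=> b IHb c IHc U V a'; case Eb: usub_g_gen => [[Vb b']|//].
  case Ec: usub_g_gen => [[Vc c']|//] [<- <-].
  have [Ub bV Hb] := IHb _ _ _ Eb; have [bc cV Hc] := IHc _ _ _ Ec; split.
  + exact: fintype.subset_trans Ub bc.
  + by apply: bound_in_seq => //; exact: bound_in_sub bc bV.
  + move=> I X v w vw /=; rewrite -(Hb _ _ _ _ vw).
    apply: bound_in_eq bV _ => u uv; apply: Hc.
    by apply: agree_off_trans uv _; exact: agree_off_sub vw.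
- move=> b IHb U V a'; case E: usub_g_gen => [[V1 b1]|//].
  case E2: usub_g_gen => [[W b']|//]; case: eqP => // WV [<- <-].
  (* The first pass is used for the inclusion of taboos; the second, from [V] to [V], is correct in
     every round. *)
  have [UV _ _] := IHb _ _ _ E; have [_ bV Hb] := IHb _ _ _ E2; subst W.
  split => //; first exact: bound_in_star.
  move=> I X v w vw; apply: (sem_g_star_adjoint _ bV).
    by move=> Y u uw; exact: Hb.
  exact: agree_off_sub vw.
- move=> b IHb U V a'; case E: usub_g_gen => [[V1 b']|//] [<- <-].
  have [UV bV Hb] := IHb _ _ _ E; split => //; first exact: bound_in_dual.
  by move=> I X v w vw; congr (~ _); exact: Hb.
Qed.

End Stratum.

(** * Discharging the stratification, and soundness *)

Lemma dot_tP e t e' I w : dot_t R e t = Some e' ->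
  sem_t I e' w = sem_t (interp_dot I (sem_t I t w)) e w.
(* Here instantiation always yields [None], so the assumption on it holds vacuously. *)
Proof. by move=> E; rewrite -adjoint_dot; apply: (usub_t_genP _ _ E). Qed.

Lemma dot_fP p t p' I w : dot_f R p t = Some p' ->
  sem_f I p' w = sem_f (interp_dot I (sem_t I t w)) p w.
Proof.
move=> E; rewrite -adjoint_dot.
by apply: (proj1 (usub_fg_genP _ _ (dot_subst t)) _ _ _ E).
Qed.

Lemma usub_fP s U p p' I v w : usub_f R s U p = Some p' -> agree_off U v w ->
  sem_f I p' v = sem_f (adjoint s I w) p v.
Proof. by move=> E; exact: (proj1 (usub_fg_genP dot_tP dot_fP s) _ _ _ E). Qed.

End Adjoint.

Theorem theorem18 (R : realType) (S : signature) (sigma : usubst S)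
    (phi psi : formula S) :
  usub_f R sigma finset.set0 phi = Some psi -> valid R phi -> valid R psi.
Proof.
move=> E vphi I; apply/seteqP; split => // w _.
(* The adjoint is taken at [w] itself and varies with it; validity of [phi] covers all these
   interpretations. *)
by rewrite (usub_fP I E (@agree_off_refl _ _ _ w)) vphi.
Qed.
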